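(* Let $n,k$ be non-negative integers. The inclusion of pointed sets \[\bigvee_{k}\mathrm{Plas}(\mathcal{P}(n),\mathbb{K})\hookrightarrow \mathrm{Plas}\Bigl(\mathcal{P}(n),\bigvee_k\mathbb{K}\Bigr)\] given by composing with the $k$ different coproduct inclusions $\mathbb{K}\hookrightarrow\bigvee_k\mathbb{K}$ is an isomorphism.
   Context: A plasma is a set $X$ with a hyperoperation $\star\colon X\times X\to\mathcal{P}(X)$ (empty values allowed) and an element $0\in X$ (the weak identity) such that $x\star y=y\star x$ for all $x,y\in X$ and $x\in x\star 0$ for all $x\in X$. A morphism $(X,\star,0)\to(Y,\boxplus,e)$ is a function $f\colon X\to Y$ with $f(0)=e$ and $f(x\star x')\subseteq f(x)\boxplus f(x')$ for all $x,x'$. $\mathrm{Plas}(X,Y)$ is the set of plasma morphisms, pointed by the constant morphism at the weak identity of $Y$. The Krasner hypergroup $\mathbb{K}$ is the plasma $\{0,1\}$ with weak identity $0$ and $0+0=\{0\}$, $0+1=1+0=\{1\}$, $1+1=\{0,1\}$. The $k$-fold coproduct $\bigvee_k\mathbb{K}$ in the category of plasmas is the wedge sum $\{0,1,\ldots,k\}$ of $k$ copies of $\mathbb{K}$ with weak identity $0$, with $0+0=\{0\}$, $0+i=i+0=\{i\}$, $i+i=\{0,i\}$ and $i+j=\varnothing$ (the empty set) for $i\ne j$, $i,j\geq 1$. $\mathcal{P}(n)$ is the power set plasma of $\{1,\ldots,n\}$: its underlying set is the power set of $\{1,\ldots,n\}$, its weak identity is the empty set $\varnothing$, and $a\star b=\{a\cup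 b\}$ if $a\cap b=\varnothing$, while $a\star b$ is the empty family if $a\cap b\neq\varnothing$. $\bigvee_k$ of pointed sets denotes the wedge sum (coproduct of pointed sets). *)

(* Defs.v *)
From HB Require Import structures.
From mathcomp Require Import all_boot.
From mathcomp Require Import boolp classical_sets.

Set Implicit Arguments.
Unset Strict Implicit.
Unset Printing Implicit Defensive.

Local Open Scope classical_set_scope.

HB.mixin Record isPlasma X := {
  hop : X -> X -> set X;
  weak_id : X;
  hopC : forall x y, hop x y = hop y x;
  hop_weak_id : forall x, hop x weak_id x
}.

#[short(type="plasmaType")]
HB.structure Definition Plasma := { X of isPlasma X }.

Arguments weak_id {s}.

Definition plasma_morphism (X Y : plasmaType) (f : X -> Y) : Prop :=
  f weak_id = weak_id /\
  forall x x', f @` hop x x' `<=` hop (f x) (f x').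

Record Plas (X Y : plasmaType) := MkPlas {
  plas_fun :> X -> Y;
  plasP : plasma_morphism plas_fun
}.

Lemma plas_ext (X Y : plasmaType) (f g : Plas X Y) : f =1 g -> f = g.
Proof.
case: f g => [f fP] [g gP] /= /funext fg; case: _ / fg in gP *.
by rewrite (Prop_irrelevance fP gP).
Qed.

Lemma plasma_morphism_cst (X Y : plasmaType) :
  plasma_morphism (fun _ : X => weak_id : Y).
Proof. by split=> // x x' _ [z _ <-]; exact: hop_weak_id. Qed.

Definition plas_cst (X Y : plasmaType) : Plas X Y :=
  MkPlas (@plasma_morphism_cst X Y).

HB.instance Definition _ (X Y : plasmaType) := gen_eqMixin (Plas X Y).
HB.instance Definition _ (X Y : plasmaType) := gen_choiceMixin (Plas X Y).
HB.instance Definition _ (X Y : plasmaType) :=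
  isPointed.Build (Plas X Y) (plas_cst X Y).

Lemma plasma_morphism_comp (X Y Z : plasmaType) (g : Plas Y Z) (f : Plas X Y) :
  plasma_morphism (g \o f).
Proof.
split=> [|x x' _ [z xz <-]] /=; first by rewrite (plasP f).1 (plasP g).1.
by apply: (plasP g).2; exists (f z) => //; apply: (plasP f).2; exists z.
Qed.

Definition plas_comp (X Y Z : plasmaType) (g : Plas Y Z) (f : Plas X Y) :
  Plas X Z := MkPlas (plasma_morphism_comp g f).

(* [false] is 0 and [true] is 1. *)
Definition krasner : Type := bool.

Definition krasner_hop (x y : krasner) : set krasner :=
  match x, y with
  | false, false => [set false]
  | false, true | true, false => [set true]
  | true, true => [set false; true]
  end.

Lemma krasner_hopC x y : krasner_hop x y = krasner_hop y x.
Proof. by case: x; case: y. Qed.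

Lemma krasner_hop0 x : krasner_hop x false x.
Proof. by case: x. Qed.

HB.instance Definition _ :=
  isPlasma.Build krasner krasner_hopC krasner_hop0.

(* The underlying set is {0, ..., k}. *)
Definition krasner_wedge (k : nat) : Type := 'I_k.+1.

Definition krasner_wedge_hop (k : nat) (x y : krasner_wedge k) :
    set (krasner_wedge k) :=
  if x == ord0 :> 'I_k.+1 then [set y]
  else if y == ord0 :> 'I_k.+1 then [set x]
  else if x == y :> 'I_k.+1 then [set (ord0 : 'I_k.+1); x]
  else set0.

Lemma krasner_wedge_hopC k (x y : krasner_wedge k) :
  krasner_wedge_hop x y = krasner_wedge_hop y x.
Proof.
rewrite /krasner_wedge_hop; have [x0|x0] := eqVneq (x : 'I_k.+1) ord0.
  by have [y0|//] := eqVneq (y : 'I_k.+1) ord0; rewrite x0 y0.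
have [//|y0] := eqVneq (y : 'I_k.+1) ord0; rewrite [in RHS]eq_sym.
by have [->|] := eqVneq (x : 'I_k.+1) y.
Qed.

Lemma krasner_wedge_hop0 k (x : krasner_wedge k) :
  krasner_wedge_hop x (ord0 : 'I_k.+1) x.
Proof. by rewrite /krasner_wedge_hop eqxx; case: eqVneq. Qed.

HB.instance Definition _ (k : nat) :=
  isPlasma.Build (krasner_wedge k) (@krasner_wedge_hopC k) (@krasner_wedge_hop0 k).

(* The i-th copy of [krasner], i : 'I_k, sits at {0, i + 1}. *)
Definition krasner_in_fun (k : nat) (i : 'I_k) (x : krasner) : krasner_wedge k :=
  if x then lift ord0 i else ord0.

Lemma krasner_in_morphism k (i : 'I_k) : plasma_morphism (krasner_in_fun i).
Proof.
split=> // x y _ [z xyz <-]; move: xyz.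
rewrite /hop /= /krasner_wedge_hop /krasner_in_fun.
case: x; case: y => /=; try by move=> ->; rewrite ?eqxx.
by case=> ->; rewrite eqxx; [left | right].
Qed.

Definition krasner_in (k : nat) (i : 'I_k) : Plas krasner (krasner_wedge k) :=
  MkPlas (krasner_in_morphism i).

Lemma krasner_wedge_coproduct (k : nat) (Y : plasmaType)
    (f : 'I_k -> Plas krasner Y) :
  exists! h : Plas (krasner_wedge k) Y,
    forall i, plas_comp h (krasner_in i) = f i.
Proof.
pose h (x : krasner_wedge k) : Y :=
  if unlift ord0 (x : 'I_k.+1) is Some i then f i true else weak_id.
have h0 : h (ord0 : 'I_k.+1) = weak_id by rewrite /h unlift_none.
have hS i : h (lift ord0 i) = f i true by rewrite /h liftK.
have hP : plasma_morphism h.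
  split=> [|x y _ [z + <-]]; first exact: h0.
  rewrite [hop x y]/(krasner_wedge_hop x y) /krasner_wedge_hop.
  have [-> ->|x0] := eqVneq (x : 'I_k.+1) ord0.
    by rewrite h0 hopC; exact: hop_weak_id.
  have [-> ->|y0] := eqVneq (y : 'I_k.+1) ord0.
    by rewrite h0; exact: hop_weak_id.
  have [<-|//] := eqVneq (x : 'I_k.+1) y.
  have [i ->|x0'] := unliftP ord0 (x : 'I_k.+1); last by rewrite x0' eqxx in x0.
  case=> ->; rewrite ?h0 hS; apply: (plasP (f i)).2.
    by exists false; [left | exact: (plasP (f i)).1].
  by exists true; [right |].
exists (MkPlas hP); split=> [i|g gf].
  apply: plas_ext => -[] /=; first exact: hS.
  by rewrite [LHS]h0 (plasP (f i)).1.
apply: plas_ext => x /=; have [i ->|->] := unliftP ord0 (x : 'I_k.+1).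
  by rewrite hS -gf.
by rewrite h0; symmetry; exact: (plasP g).1.
Qed.

(* 'I_n stands for {1, ..., n}. *)
Definition powerset_plasma (n : nat) : Type := {set 'I_n}.

Definition powerset_hop (n : nat) (a b : {set 'I_n}) : set {set 'I_n} :=
  if (a :&: b)%SET == finset.set0 then [set (a :|: b)%SET] else set0.

Lemma powerset_hopC n (a b : {set 'I_n}) : powerset_hop a b = powerset_hop b a.
Proof. by rewrite /powerset_hop finset.setIC finset.setUC. Qed.

Lemma powerset_hop0 n (a : {set 'I_n}) : powerset_hop a finset.set0 a.
Proof. by rewrite /powerset_hop finset.setI0 eqxx finset.setU0. Qed.

HB.instance Definition _ (n : nat) :=
  isPlasma.Build (powerset_plasma n) (@powerset_hopC n) (@powerset_hop0 n).

Definition pointed_map (X Y : pointedType) (f : X -> Y) : Prop :=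
  f point = point.

Definition pointed_iso (X Y : pointedType) (f : X -> Y) : Prop :=
  pointed_map f /\
  exists g : Y -> X, [/\ pointed_map g, cancel f g & cancel g f].

(* [None] is the base point, and the other elements are the pairs (i, x) with
   x : X i not the base point. *)
Definition pwedge (I : choiceType) (X : I -> pointedType) : Type :=
  option {p : {i : I & X i} | tagged p != point}.

HB.instance Definition _ (I : choiceType) (X : I -> pointedType) :=
  Pointed.on (pwedge X).

(* [insub] sends (i, point) to [None]. *)
Definition pwedge_in (I : choiceType) (X : I -> pointedType) (i : I) (x : X i) :
  pwedge X := insub (Tagged (fun i => X i) x).

Definition pwedge_copair (I : choiceType) (X : I -> pointedType)
    (Y : pointedType) (f : forall i, X i -> Y) (w : pwedge X) : Y :=
  if w is Some p then f (tag (val p)) (tagged (val p)) else point.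

Lemma pwedge_coproduct (I : choiceType) (X : I -> pointedType)
    (Y : pointedType) (f : forall i, X i -> Y) :
  (forall i, pointed_map (f i)) ->
  forall h : pwedge X -> Y,
    (pointed_map h /\ forall i x, h (pwedge_in x) = f i x) <->
    h = pwedge_copair f.
Proof.
move=> fP h; split=> [[h0 hf]|->].
  apply: funext => -[[[i x] /= xP]|//]; rewrite /= -hf /pwedge_in; congr h.
  by rewrite insubT.
split=> // i x; rewrite /pwedge_in.
by case: insubP => [[q qP] /= _ ->//|/negPn/eqP/= ->]; rewrite fP.
Qed.

Definition plas_wedge_incl (n k : nat) :
    pwedge (fun _ : 'I_k => Plas (powerset_plasma n) krasner : pointedType) ->
    Plas (powerset_plasma n) (krasner_wedge k) :=
  pwedge_copair (fun i f => plas_comp (krasner_in i) f).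

(* Main.v *)
From mathcomp Require Import boolp classical_sets.
From mathcomp Require Import all_boot.
Require Import Defs.

(** A morphism [f] from the power set plasma to the wedge of [k] copies of the
    Krasner hypergroup takes at most one nonzero value, and so factors through
    a single copy.  Indeed, the sum of two distinct nonzero elements of the
    wedge is empty, while the sum of two disjoint subsets in the power set is
    nonempty; hence nonzero values at disjoint subsets agree.  Suppose [f a] and [f b] are
    nonzero and distinct.  Then [f (a \ b)] cannot be [f a], because [a \ b] is
    disjoint from [b].  As [a] is the sum of [a \ b] and [a & b], and as a
    nonzero element of a sum is one of the summands, [f (a & b) = f a].  By
    symmetry [f (a & b) = f b], a contradiction: this is
    [plas_wedge_single_value].

    The component of [f] in the copy it factors through is recovered by
    composing with [krasner_fold], the morphism from the wedge to one copy that
    is the identity on each of them.  The index of the copy is read off from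
    any nonzero value of [f]. *)

Set Implicit Arguments.
Unset Strict Implicit.
Unset Printing Implicit Defensive.

Lemma krasner_wedge_hop_nonzero k (x y z : krasner_wedge k) :
  hop x y z -> z <> weak_id -> x = z \/ y = z.
Proof.
rewrite [hop x y]/(krasner_wedge_hop x y) /krasner_wedge_hop.
case: eqVneq => [_ -> _|_]; first by right.
case: eqVneq => [_ -> _|_]; first by left.
by case: eqVneq => // _ [->|->]; [|left].
Qed.

Lemma krasner_wedge_hop_eq k (x y z : krasner_wedge k) :
  hop x y z -> x <> weak_id -> y <> weak_id -> x = y.
Proof.
rewrite [hop x y]/(krasner_wedge_hop x y) /krasner_wedge_hop.
case: eqVneq => [-> //|_]; case: eqVneq => [-> //|_].
by case: eqVneq.
Qed.

Section FoldMorphism.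
Variable k : nat.

Definition krasner_fold_fun (x : krasner_wedge k) : krasner :=
  (x : 'I_k.+1) != ord0.

Lemma krasner_fold_morphism : plasma_morphism krasner_fold_fun.
Proof.
split=> [|x y _ [z xyz <-]]; first by rewrite /krasner_fold_fun eqxx.
move: xyz; rewrite [hop x y]/(krasner_wedge_hop x y) /krasner_wedge_hop.
rewrite [hop _ _]/(krasner_hop _ _) /krasner_fold_fun.
case: (eqVneq (x : 'I_k.+1) ord0) => [_ ->|x0].
  by case: (eqVneq (y : 'I_k.+1) ord0).
case: (eqVneq (y : 'I_k.+1) ord0) => [_ ->|y0] /=; first by rewrite x0.
case: (eqVneq (x : 'I_k.+1) y) => // _ [->|->]; first by rewrite eqxx; left.
by rewrite x0; right.
Qed.

Definition krasner_fold : Plas (krasner_wedge k) krasner :=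
  MkPlas krasner_fold_morphism.

Lemma krasner_foldK (i : 'I_k) : cancel (krasner_in i) krasner_fold.
Proof. by case; rewrite /= /krasner_fold_fun /krasner_in_fun ?eqxx. Qed.

Lemma krasner_in_fold (i : 'I_k) (x : krasner_wedge k) :
  x = weak_id \/ x = lift ord0 i -> krasner_in i (krasner_fold x) = x.
Proof. by case=> ->; rewrite /= /krasner_fold_fun /krasner_in_fun ?eqxx. Qed.

End FoldMorphism.

Section PowersetMorphisms.
Variables n k : nat.
Implicit Types f : Plas (powerset_plasma n) (krasner_wedge k).

Lemma plas_powerset_hop (Y : plasmaType) (f : Plas (powerset_plasma n) Y)
    (a b : {set 'I_n}) : [disjoint a & b] -> hop (f a) (f b) (f (a :|: b)).
Proof.
rewrite -setI_eq0 => ab; apply: (plasP f).2; exists (a :|: b) => //.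
by rewrite [hop _ _]/(powerset_hop a b) /powerset_hop ab.
Qed.

(** As [a \ b] is disjoint from [b], the value [f b] excludes the value [f a] at
    [a \ b], so that [a & b] is the summand of [a] that carries it. *)
Lemma plas_wedge_value_inter f (a b : {set 'I_n}) :
  f a <> weak_id -> f b <> weak_id -> f a <> f b -> f (a :&: b) = f a.
Proof.
move=> fa0 fb0 fab.
have disj : [disjoint a :&: b & a :\: b].
  by rewrite -setI_eq0 setDE setIACA setICr setI0.
have := plas_powerset_hop f disj; rewrite setID.
move=> /krasner_wedge_hop_nonzero /(_ fa0) [//|fD].
have Db : [disjoint a :\: b & b] by rewrite -setI_eq0 setDE -setIA (setIC (~: b)) setICr setI0.
case: fab; rewrite -fD.
by apply: (krasner_wedge_hop_eq (plas_powerset_hop f Db)) => //; rewrite fD.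
Qed.

Lemma plas_wedge_single_value f (a b : {set 'I_n}) :
  f a <> weak_id -> f b <> weak_id -> f a = f b.
Proof.
move=> fa0 fb0; apply: contrapT => fab; apply: (fab).
rewrite -(plas_wedge_value_inter fa0 fb0 fab) setIC.
by apply: plas_wedge_value_inter => // /esym.
Qed.

(** By [plas_wedge_single_value] the index of the copy does not depend on which
    [a] with a nonzero value is picked; if there is none, [f] is constant and
    goes to the base point. *)
Definition plas_wedge_split f :
    pwedge (fun _ : 'I_k => Plas (powerset_plasma n) krasner : pointedType) :=
  if [pick a : {set 'I_n} | (f a : 'I_k.+1) != ord0] is Some a then
    if unlift ord0 (f a : 'I_k.+1) is Some i then
      pwedge_in (X := fun _ : 'I_k => Plas (powerset_plasma n) krasner)
        (i := i) (plas_comp (krasner_fold k) f)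
    else None
  else None.

Lemma plas_wedge_incl_in (i : 'I_k) (g : Plas (powerset_plasma n) krasner) :
  plas_wedge_incl (pwedge_in
    (X := fun _ : 'I_k => Plas (powerset_plasma n) krasner) (i := i) g) =
  plas_comp (krasner_in i) g.
Proof.
rewrite /plas_wedge_incl /pwedge_in; case: insubP => [[q qP] _ /= -> //|].
by move=> /negPn/eqP /= ->; exact: plas_ext.
Qed.

Lemma plas_wedge_split_cst : plas_wedge_split point = None.
Proof. by rewrite /plas_wedge_split; case: pickP => // a; rewrite eqxx. Qed.

Lemma plas_wedge_inclK : cancel (@plas_wedge_incl n k) plas_wedge_split.
Proof.
case=> [[[i g] g0]|]; last exact: plas_wedge_split_cst.
rewrite /plas_wedge_incl /= /plas_wedge_split /=.
case: pickP => [a|g_eq0].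
  rewrite /krasner_in_fun; case: ifP => // _ _; rewrite liftK.
  have -> : plas_comp (krasner_fold k) (plas_comp (krasner_in i) g) = g.
    by apply: plas_ext => b; exact: krasner_foldK.
  by rewrite /pwedge_in insubT.
case/eqP: g0; apply: plas_ext => a /=.
by have := g_eq0 a; rewrite /krasner_in_fun; case: (g a).
Qed.

Lemma plas_wedge_splitK : cancel plas_wedge_split (@plas_wedge_incl n k).
Proof.
move=> f; rewrite /plas_wedge_split; case: pickP => [a fa0|f_eq0].
  have [i fai|fa] := unliftP ord0 (f a : 'I_k.+1); last by rewrite fa eqxx in fa0.
  rewrite plas_wedge_incl_in; apply: plas_ext => b.
  apply: krasner_in_fold; rewrite -fai.
  have [fb|fb] := eqVneq (f b : 'I_k.+1) ord0; [by left|right].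
  by apply: plas_wedge_single_value; apply/eqP.
by apply: plas_ext => a; have /eqP := negbFE (f_eq0 a).
Qed.

End PowersetMorphisms.

Theorem proposition3p4 (n k : nat) : pointed_iso (@plas_wedge_incl n k).
Proof.
split=> //; exists (@plas_wedge_split n k); split.
- exact: plas_wedge_split_cst.
- exact: plas_wedge_inclK.
- exact: plas_wedge_splitK.
Qed.
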